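(* (1) There exist $\varphi$-equivalent sequences $\overline a,\overline b$ such that $G_\varphi$ is a path and $\mathcal L_\varphi(n)=\Omega(n\log\log n)$. (2) For every integer $m\ge 2$ there exist $\varphi$-equivalent sequences $\overline a,\overline b$ such that $G_\varphi$ contains only cycles of length $\le m$ and $\mathcal L_\varphi(n)=\Omega(n^{m-1-\varepsilon})$ for every $\varepsilon>0$. (3) There exist $\varphi$-equivalent sequences $\overline a,\overline b$ such that $\mathcal L_\varphi(n)=\exp\Omega(\sqrt[3]{n})$.
   Context: $\mathbb P$ is the set of positive integers. A partition $\lambda$ is a finite multiset of positive integers; $m_i(\lambda)$ is the number of parts equal to $i$ and $|\lambda|$ the sum of the parts. Sequences $\overline a=(a_1,a_2,\dots)$, $\overline b=(b_1,b_2,\dots)$ have entries in $\mathbb P\cup\{\infty\}$, and $\operatorname{supp}(\overline a)=\{i:a_i<\infty\}$. They are $\varphi$-equivalent if $\varphi\colon\operatorname{supp}(\overline a)\to\operatorname{supp}(\overline b)$ is a bijection with $ia_i=\varphi(i)b_{\varphi(i)}$ for all $i\in\operatorname{supp}(\overline a)$. $\mathcal A$ is the set of partitions $\lambda$ with $m_i(\lambda)<a_i$ for all $i$, and $\mathcal A_n$ those of size $n$. O'Hara's algorithm: on input $\lambda\in\mathcal A$, set $\mu\leftarrow\lambda$; while there is $j$ with $m_j(\mu)\ge b_j$, remove $b_j$ copies of $j$ and add $a_i$ copies of $i$, where $\varphi(i)=j$; output $\mu$ (the number of steps is known to be finite and independent of choices). $L_\varphi(\lambda)$ is the number of steps on input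 $\lambda$ and $\mathcal L_\varphi(n)=\max_{\lambda\in\mathcal A_n}L_\varphi(\lambda)$. $G_\varphi$ is the directed graph on $\operatorname{supp}(\overline a)\cup\operatorname{supp}(\overline b)$ with an edge $i\to j$ whenever $\varphi(j)=i$. *)

(* Defs.v *)
From HB Require Import structures.
From mathcomp Require Import all_boot all_order all_algebra.
From mathcomp Require Import finmap multiset.
From mathcomp Require Import all_classical all_reals all_analysis.
From Stdlib Require Import Relation_Operators.

Set Implicit Arguments.
Unset Strict Implicit.
Unset Printing Implicit Defensive.

Import Order.TTheory GRing.Theory Num.Theory.

Local Open Scope classical_set_scope.

Definition posint := {n : nat | 0 < n}.

Definition intpart := {mset posint}%mset.

(* For [la : intpart], [la i] is the multiplicity of [i] in [la]. *)
Definition psize (la : intpart) : nat := \sum_(i <- enum_mset la) val i.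

(* [None] stands for infinity. *)
Definition extseq := posint -> option posint.

Definition supp (a : extseq) : set posint := [set i | a i <> None].

(* Values of [phi] outside [supp a] are irrelevant here and below. *)
Definition phi_equivalent (a b : extseq) (phi : posint -> posint) : Prop :=
  set_bij (supp a) (supp b) phi /\
  forall i k l, a i = Some k -> b (phi i) = Some l ->
    val i * val k = val (phi i) * val l.

Definition bounded_by (a : extseq) : set intpart :=
  [set la | forall i k, a i = Some k -> la i < val k].

Definition bounded_by_of_size (a : extseq) (n : nat) : set intpart :=
  [set la | bounded_by a la /\ psize la = n].

Definition ohara_step (a b : extseq) (phi : posint -> posint)
    (mu nu : intpart) : Prop :=
  exists i j k l,
    [/\ a i = Some k, b j = Some l, phi i = j, val l <= mu j &
        nu = ((mu `\` msetn (val l) j) `+` msetn (val k) i)%mset].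

Fixpoint ohara_steps (a b : extseq) (phi : posint -> posint) (k : nat)
    (mu nu : intpart) : Prop :=
  if k is k'.+1 then
    exists2 mu', ohara_step a b phi mu mu' & ohara_steps a b phi k' mu' nu
  else mu = nu.

(* The loop stops exactly when no multiplicity [m_j] reaches [b_j], that is,
   when the current partition lies in [bounded_by b].  For phi-equivalent [a]
   and [b] and [la] in [bounded_by a], complete runs on [la] exist and all have
   the same length, so the set below is a singleton. *)
Definition ohara_length (a b : extseq) (phi : posint -> posint)
    (la : intpart) : nat :=
  xget 0 [set k | exists2 mu, ohara_steps a b phi k la mu & bounded_by b mu].

(* The maximum over the empty set is 0. *)
Definition ohara_max_length (a b : extseq) (phi : posint -> posint)
    (n : nat) : nat :=
  \big[maxn/0]_(la \in bounded_by_of_size a n) ohara_length a b phi la.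

Definition ohara_vertices (a b : extseq) : set posint := supp a `|` supp b.

Definition ohara_edge (a : extseq) (phi : posint -> posint)
    (i j : posint) : Prop := supp a j /\ phi j = i.

(* A directed path, finite, or infinite in one or both directions: its vertices
   are indexed by a nonempty interval of integers. *)
Definition is_dipath (T : Type) (V : set T) (E : T -> T -> Prop) : Prop :=
  exists (I : set int) (f : int -> T),
    [/\ I !=set0, is_interval I, set_bij I V f &
        forall p q, I p -> I q -> (E (f p) (f q) <-> q = (p + 1)%R)].

(* A directed cycle of length [k]; for [k = 1] it is a loop. *)
Definition is_dicycle (T : Type) (k : nat) (V : set T) (E : T -> T -> Prop)
    : Prop :=
  exists f : 'I_k -> T,
    set_bij [set: 'I_k] V f /\ forall p q, E (f p) (f q) <-> q = ordS p.

Definition component (T : Type) (E : T -> T -> Prop) (v : T) : set T :=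
  [set w | clos_refl_sym_trans T E v w].

Definition only_dicycles_of_length_le (T : Type) (m : nat) (V : set T)
    (E : T -> T -> Prop) : Prop :=
  forall v, V v -> exists2 k, k <= m & is_dicycle k (component E v) E.

(* Main.v *)
(* Steps at different places commute, for the algorithm as well as for its
   reversal.  Hence all complete runs from a partition of [A] have the same
   length, no state is visited twice, and the algorithm stops.  Put
   [w_i = i a_i], and let [f_i] be the number of steps creating parts [i] in a
   complete run from [la].  Since the final multiplicities are smaller than the
   [b_j], counting the parts [j = phi i] gives
   [j (la_j + 1) + w_j f_j <= w_i (f_i + 1)].

   Path: take [1 -> 2 -> 3 -> 6 -> 5 -> 10 -> ...] and start from [n] parts [1].
   Up to a loss that is polynomial in the position, the whole weight [n] crosses
   each edge [x -> 2 x] with [x] odd, in portions of size [2 x]; summing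
   [n / 2 x] over the odd [x] up to a power of [n] gives order [n log n].

   Cycles: start from the multiplicities [a_i - 1] on one cycle.  Then
   [w_i (f_i + 1)] cannot decrease along the cycle, so it is constant, and a
   common multiple of the weights.  With [m] weights of size about [N] that are
   nearly pairwise coprime this is of order [N^m]; with the cycle on
   [N, ..., 2 N - 1] and the weights [i (i - 1)] it is at least [2^N], for a
   partition of size of order [N^3]. *)

Require Import Defs.
From mathcomp Require Import all_boot all_order all_algebra.
From mathcomp Require Import finmap multiset.
From mathcomp Require Import all_classical all_reals all_analysis.
From mathcomp Require Import unstable zify ring lra.
From Stdlib Require Import Relation_Operators.

Set Implicit Arguments.
Unset Strict Implicit.
Unset Printing Implicit Defensive.

Import Order.TTheory GRing.Theory Num.Theory.

Local Open Scope classical_set_scope.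

(** * Rewriting systems with the strong diamond property *)

Section Rewriting.
Variable T : Type.
Implicit Types (R : T -> T -> Prop) (x y z : T).

Fixpoint nsteps R k x y : Prop :=
  if k is k'.+1 then exists2 z, R x z & nsteps R k' z y else x = y.

Definition strong_diamond R : Prop :=
  forall x y z, R x y -> R x z -> y = z \/ exists2 w, R y w & R z w.

Definition terminal R x : Prop := forall y, ~ R x y.

Lemma nstepsSr R k x y z : nsteps R k x y -> R y z -> nsteps R k.+1 x z.
Proof.
elim: k x => [x -> Ryz|k IHk x [u Rxu uy] Ryz]; first by exists z.
by exists u => //; exact: IHk.
Qed.

Lemma nsteps_transp R k x y : nsteps R k x y -> nsteps (transp T R) k y x.
Proof.
elim: k x => [x //|k IHk x [u Rxu uy]].
exact: nstepsSr (IHk _ uy) Rxu.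
Qed.

Lemma nsteps_invariant R (P : set T) k x y :
  (forall u v, P u -> R u v -> P v) -> P x -> nsteps R k x y -> P y.
Proof.
move=> PR; elim: k x => [x Px <- //|k IHk x Px [z Rxz]].
exact/IHk/(PR _ _ Px Rxz).
Qed.

Lemma strong_diamond_nsteps R k l x y z : strong_diamond R ->
  nsteps R k x y -> terminal R y -> nsteps R l x z ->
  l <= k /\ nsteps R (k - l) z y.
Proof.
move=> dR; elim: k x l z => [x [|l] z //= -> ty|k IHk x [|l] z /=].
- by move<-.
- by case=> u /ty.
- by move=> [u Rxu uy] ty <-; split => //; exists u.
move=> [u Rxu uy] ty [v Rxv vz].
have vy : nsteps R k v y.
  have [<-//|[w Ruw Rvw]] := dR _ _ _ Rxu Rxv.
  have uw : nsteps R 1 u w by exists w.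
  have [k_gt0 wy] := IHk _ _ _ uy ty uw.
  by rewrite -(subnKC k_gt0) add1n; exists w.
by have [lk zy] := IHk _ _ _ vy ty vz; rewrite subSS.
Qed.

Lemma nsteps_terminal_uniq R k l x y z : strong_diamond R ->
  nsteps R k x y -> terminal R y -> nsteps R l x z -> terminal R z -> k = l.
Proof.
move=> dR xy ty xz tz.
have [lk _] := strong_diamond_nsteps dR xy ty xz.
have [kl _] := strong_diamond_nsteps dR xz tz xy.
by apply/eqP; rewrite eqn_leq kl lk.
Qed.

Lemma nsteps_inj R k l x y : strong_diamond (transp T R) ->
  terminal (transp T R) x -> nsteps R k x y -> nsteps R l x y -> k = l.
Proof.
move=> dR tx /nsteps_transp yx /nsteps_transp yx'.
exact: (nsteps_terminal_uniq dR yx tx yx' tx).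
Qed.

(* An infinite run would visit some state twice, which [nsteps_inj] forbids. *)
Lemma nsteps_terminates R (P : set T) x :
  strong_diamond (transp T R) -> terminal (transp T R) x ->
  finite_set P -> P x -> (forall y z, P y -> R y z -> P z) ->
  exists k y, nsteps R k x y /\ terminal R y.
Proof.
move=> dR tx finP Px PR; apply: contrapT => no_end.
have progress y : exists z, (exists k, nsteps R k x y) -> R y z.
  have [[z Ryz]|stuck] := pselect (exists z, R y z); first by exists z.
  exists y => -[k xy]; exfalso; apply: no_end; exists k, y.
  by split=> // z Ryz; apply: stuck; exists z.
have [next nextP] := choice progress.
have run k : nsteps R k x (iter k next x).
  elim: k => [//|k IHk]; apply: (nstepsSr IHk).
  by rewrite iterS; apply: nextP; exists k.
have run_inj : injective (fun k => iter k next x).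
  by move=> k l /= kl; apply: nsteps_inj dR tx (run k) _; rewrite kl.
apply: infinite_nat; rewrite -(eq_finite_set (inj_card_eq (in2W run_inj))).
apply: sub_finite_set finP => _ [k _ <-].
exact: nsteps_invariant PR Px (run k).
Qed.

End Rewriting.

(** * Chip firing *)

Section Firing.
Variables (K : choiceType) (I : Type) (D : set I).
Implicit Types (mu nu : {mset K}%mset) (src tgt : I -> K) (out gain : I -> nat).

Definition fire src tgt out gain i mu : {mset K}%mset :=
  ((mu `\` msetn (out i) (src i)) `+` msetn (gain i) (tgt i))%mset.

Definition fire_step src tgt out gain mu nu : Prop :=
  exists2 i, D i & out i <= mu (src i) /\ nu = fire src tgt out gain i mu.

Lemma fireE src tgt out gain i mu x : fire src tgt out gain i mu x =
  mu x - (if x == src i then out i else 0) +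
  (if x == tgt i then gain i else 0).
Proof. by rewrite /fire msetE2 msetE2 !msetnE. Qed.

Lemma leq_fire src tgt out gain i mu x :
  x != src i -> mu x <= fire src tgt out gain i mu x.
Proof. by move=> /negbTE xi; rewrite fireE xi subn0 leq_addr. Qed.

Lemma fireC src tgt out gain i j mu : src i != src j ->
  out i <= mu (src i) -> out j <= mu (src j) ->
  fire src tgt out gain i (fire src tgt out gain j mu) =
  fire src tgt out gain j (fire src tgt out gain i mu).
Proof.
move=> ij le_i le_j; apply/msetP => x; rewrite !fireE.
have [->|_] := eqVneq x (src i); first by rewrite (negbTE ij); lia.
by have [->|_] := eqVneq x (src j); lia.
Qed.

Lemma fireK src tgt out gain i mu : out i <= mu (src i) ->
  fire tgt src gain out i (fire src tgt out gain i mu) = mu.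
Proof.
move=> le_i; apply/msetP => x; rewrite !fireE.
by case: (x =P src i) => [->|_]; lia.
Qed.

Lemma fire_step_diamond src tgt out gain : {in D &, injective src} ->
  strong_diamond (fire_step src tgt out gain).
Proof.
move=> src_inj mu _ _ [i Di [le_i ->]] [j Dj [le_j ->]].
have [ij|ij] := eqVneq (src i) (src j).
  by left; rewrite (src_inj i j) ?inE.
right; exists (fire src tgt out gain j (fire src tgt out gain i mu)).
- exists j => //; split=> //; apply: leq_trans le_j _.
  by apply: leq_fire; rewrite eq_sym.
- exists i => //; rewrite -fireC //; split=> //.
  by apply: leq_trans le_i _; exact: leq_fire.
Qed.

Lemma transp_fire_step src tgt out gain mu nu :
  fire_step src tgt out gain mu nu -> fire_step tgt src gain out nu mu.
Proof.
move=> [i Di [le_i ->]]; exists i => //.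
by rewrite fireK // fireE eqxx leq_addl.
Qed.

Lemma transp_fire_stepE src tgt out gain :
  transp _ (fire_step src tgt out gain) = fire_step tgt src gain out.
Proof.
by apply/funext => mu; apply/funext => nu; apply/propext;
  split; exact: transp_fire_step.
Qed.

End Firing.

(** * Partitions *)

Definition pos (n : nat) : posint := insubd (exist (fun n => 0 < n) 1 isT) n.

Lemma val_pos n : 0 < n -> val (pos n) = n.
Proof. by move=> n_gt0; rewrite /pos insubdK. Qed.

Lemma pos_val (i : posint) : pos (val i) = i.
Proof. by rewrite /pos valKd. Qed.

Lemma psize0 : psize mset0 = 0.
Proof. by rewrite /psize enum_mset0 big_nil. Qed.

Lemma psizeD (A B : intpart) : psize (A `+` B)%mset = psize A + psize B.
Proof.
rewrite /psize -big_cat; apply: perm_big; apply/allP => x _ /=.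
by rewrite count_cat !count_mem_mset msetE2.
Qed.

Lemma psize_msetn k (i : posint) : psize (msetn k i) = k * val i.
Proof. by rewrite /psize enum_msetn big_nseq iter_addn addn0 mulnC. Qed.

Lemma leq_psize (A : intpart) i : A i * val i <= psize A.
Proof.
rewrite /psize (@sum_mset _ A xpredT (fun i => val i)).
case: finsuppP => [//|iA].
by rewrite (big_fsetD1 i iA) leq_addr.
Qed.

Lemma leq_count_psize (A : intpart) i : A i <= psize A.
Proof. exact: leq_trans (leq_pmulr _ (valP i)) (leq_psize A i). Qed.

Lemma count_gt_psize (A : intpart) i : psize A < val i -> A i = 0.
Proof.
move=> Ai; apply/eqP; rewrite -leqn0 -ltnS -(ltn_pmul2r (valP i)) mul1n.
exact: leq_ltn_trans (leq_psize A i) Ai.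
Qed.

Lemma finite_psize n : finite_set [set la : intpart | psize la = n].
Proof.
pose counts (A : intpart) : {ffun 'I_n.+1 -> 'I_n.+1} :=
  [ffun j : 'I_n.+1 => inord (A (pos j))].
have counts_inj : {in [set la : intpart | psize la = n] &, injective counts}.
  move=> A B; rewrite !inE /= => An Bn /ffunP eqAB; apply/msetP => i.
  have [ni|ni] := ltnP n (val i); first by rewrite !count_gt_psize ?An ?Bn.
  have := eqAB (Ordinal (ni : val i < n.+1)).
  rewrite !ffunE /= pos_val => /(congr1 (@nat_of_ord _)).
  by rewrite !inordK // ltnS -?An ?leq_count_psize // An -Bn leq_count_psize.
rewrite -(eq_finite_set (inj_card_eq counts_inj)).
exact: finite_finset.
Qed.

Section MsetOfCounts.
Variables (I : finType) (f : I -> posint) (c : I -> nat).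

Definition mset_of_counts : intpart :=
  \big[msetD/mset0]_i msetn (c i) (f i).

Lemma psize_mset_of_counts : psize mset_of_counts = \sum_i c i * val (f i).
Proof.
rewrite (big_morph psize psizeD psize0).
by apply: eq_bigr => i _; rewrite psize_msetn.
Qed.

Lemma mset_of_countsE x : mset_of_counts x = \sum_(i | x == f i) c i.
Proof.
rewrite big_mkcond; apply: (big_ind2 (fun (A : intpart) k => A x = k)).
- exact: mset0E.
- by move=> A k B l <- <-; rewrite msetE2.
- by move=> i _; rewrite msetnE.
Qed.

End MsetOfCounts.

(** * Cyclic indices *)

Lemma ordS_ind k (P : 'I_k -> Prop) p :
  P p -> (forall q, P q -> P (ordS q)) -> forall q, P q.
Proof.
move=> Pp PS q.
have iterE d : val (iter d (@ordS k) p) = (p + d) %% k.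
  elim: d => [|d IHd] /=; first by rewrite addn0 modn_small.
  by rewrite IHd -addn1 modnDml addn1 addnS.
have -> : q = iter (q + (k - p)) (@ordS k) p.
  by apply: val_inj; rewrite iterE addnCA subnKC ?modnDr ?modn_small // ltnW.
by elim: (q + _) => [//|d IHd]; exact: PS.
Qed.

Lemma ord_cyclic_monotone_constant k (G : 'I_k -> nat) :
  (forall p, G p <= G (ordS p)) -> forall p q, G q = G p.
Proof.
move=> G_mono.
have G_le p q : G p <= G q.
  move: q; apply: (ordS_ind (p := p)) => // q pq.
  exact: leq_trans pq (G_mono q).
by move=> p q; apply/eqP; rewrite eqn_leq !G_le.
Qed.

(** * O'Hara's algorithm *)

(* The value [0] encodes infinity; the finite entries are positive. *)
Definition entry (a : extseq) (i : posint) : nat := oapp val 0 (a i).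

Lemma entry_gt0 a i : (0 < entry a i) <-> supp a i.
Proof.
by rewrite /entry /supp /=; case: (a i) => [k|] //; rewrite (valP k).
Qed.

Lemma bounded_byP a la :
  bounded_by a la <-> forall i, supp a i -> la i < entry a i.
Proof.
split=> [la_lt i|la_lt i k ai].
  by rewrite /supp /entry /=; case ai: (a i) => [k|//] _; exact: la_lt ai.
by have := la_lt i; rewrite /entry /supp /= ai; apply.
Qed.

Definition weight (a : extseq) (i : posint) : nat := val i * entry a i.

Lemma weight_gt0 a i : supp a i -> 0 < weight a i.
Proof. by rewrite muln_gt0 (valP i) => /entry_gt0. Qed.

Section OHara.
Variables (a b : extseq) (phi : posint -> posint).
Hypothesis ab : phi_equivalent a b phi.

Lemma phi_equivalent_weight i :
  supp a i -> weight a i = val (phi i) * entry b (phi i).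
Proof.
have [[phiD _ _] eq_weight] := ab.
move=> si; move: (si) (phiD _ si); rewrite /weight /entry /supp /=.
case ai: (a i) => [k|//] _; case bi: (b (phi i)) => [l|//] _.
exact: eq_weight ai bi.
Qed.

Lemma ohara_stepE : ohara_step a b phi =
  fire_step (supp a) phi id (entry b \o phi) (entry a).
Proof.
have [[phiD _ _] _] := ab.
apply/funext => mu; apply/funext => nu; apply/propext; split.
  move=> [i [j [k [l [ai bj phij lmu ->]]]]].
  by exists i; rewrite /fire /supp /entry /= ?phij ?ai ?bj.
move=> [i si [lmu ->]].
move: (si) (phiD _ si) lmu; rewrite /fire /supp /entry /=.
case ai: (a i) => [k|//] _; case bi: (b (phi i)) => [l|//] _ lmu.
by exists i, (phi i), k, l.
Qed.

Lemma ohara_step_diamond : strong_diamond (ohara_step a b phi).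
Proof. by rewrite ohara_stepE; apply: fire_step_diamond; case: ab => -[]. Qed.

Lemma transp_ohara_step_diamond :
  strong_diamond (transp _ (ohara_step a b phi)).
Proof.
by rewrite ohara_stepE transp_fire_stepE; apply: fire_step_diamond => i j.
Qed.

Lemma terminal_ohara_stepP mu :
  terminal (ohara_step a b phi) mu <-> bounded_by b mu.
Proof.
have [[_ _ phi_surj] _] := ab; split=> [tmu|bmu nu].
  apply/bounded_byP => j bj; rewrite ltnNge; apply/negP => lmu.
  have [i si ij] := phi_surj j bj.
  by apply: tmu; rewrite ohara_stepE; exists i => //=; rewrite ij.
by move=> [i [j [k [l [_ /bmu + _ lmu _]]]]]; rewrite ltnNge lmu.
Qed.

Lemma bounded_by_terminal_transp la :
  bounded_by a la -> terminal (transp _ (ohara_step a b phi)) la.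
Proof.
move=> /bounded_byP bla mu; rewrite ohara_stepE transp_fire_stepE.
by move=> [i /bla + [le_i _]]; rewrite ltnNge le_i.
Qed.

Lemma psize_ohara_step mu nu : ohara_step a b phi mu nu -> psize nu = psize mu.
Proof.
rewrite ohara_stepE => -[i si [le_i ->]].
have : psize (fire phi id (entry b \o phi) (entry a) i mu
    `+` msetn (entry b (phi i)) (phi i))%mset =
    psize (mu `+` msetn (entry a i) i)%mset.
  congr psize; apply/msetP => x; rewrite msetE2 fireE msetE2 !msetnE /=.
  by move: le_i => /=; case: (x =P phi i) => [->|_]; lia.
rewrite !psizeD !psize_msetn !(mulnC (entry _ _)) -phi_equivalent_weight //.
exact: addIn.
Qed.

Lemma ohara_stepsE k mu nu :
  ohara_steps a b phi k mu nu = nsteps (ohara_step a b phi) k mu nu.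
Proof.
elim: k mu => [//|k IHk] mu /=.
by apply/propext; split=> -[mu' step]; [rewrite IHk|rewrite -IHk]; exists mu'.
Qed.

Lemma ohara_terminates la : bounded_by a la ->
  exists k mu, nsteps (ohara_step a b phi) k la mu /\ bounded_by b mu.
Proof.
move=> bla.
have [|k [mu [run /terminal_ohara_stepP bmu]]] := nsteps_terminates
    transp_ohara_step_diamond (bounded_by_terminal_transp bla)
    (finite_psize (psize la)) erefl.
  by move=> mu nu /= + /psize_ohara_step ->.
by exists k, mu.
Qed.

Lemma ohara_lengthE la mu k :
  nsteps (ohara_step a b phi) k la mu -> bounded_by b mu ->
  ohara_length a b phi la = k.
Proof.
move=> run /terminal_ohara_stepP tmu; rewrite /ohara_length.
case: xgetP => [l _ [nu]|/(_ k)[]].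
  rewrite ohara_stepsE => run' /terminal_ohara_stepP tnu.
  exact: (nsteps_terminal_uniq ohara_step_diamond run' tnu run tmu).
by exists mu; [rewrite ohara_stepsE|exact/terminal_ohara_stepP].
Qed.

Lemma leq_ohara_max_length n la : bounded_by_of_size a n la ->
  ohara_length a b phi la <= ohara_max_length a b phi n.
Proof.
move=> la_n; rewrite /ohara_max_length.
have [->//|length_neq0] := eqVneq (ohara_length a b phi la) 0.
apply: leq_bigmax_seq => //.
rewrite in_finite_support; first by rewrite inE; split=> //=; exact/eqP.
by apply: sub_finite_set (finite_psize n) => mu [[]].
Qed.

(* [f i] counts the steps that create parts [i]. *)
Lemma ohara_nsteps_balance k la mu : nsteps (ohara_step a b phi) k la mu ->
  exists f : posint -> nat,
    (forall i, supp a i -> mu (phi i) + entry b (phi i) * f i =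
                           la (phi i) + entry a (phi i) * f (phi i))
    /\ (forall r, uniq r -> \sum_(i <- r) f i <= k).
Proof.
have [[_ phi_inj _] _] := ab.
rewrite ohara_stepE; elim: k la => [la <-|k IHk la].
  by exists (fun=> 0); split=> [i _|r _]; rewrite ?muln0 ?big1.
move=> [nu [i si [le_i nuE]]] /IHk [f [fP f_le]].
exists (fun x => f x + (x == i)); split=> [j sj|r ur].
  have := fP j sj; rewrite nuE fireE /=.
  have [->|ji] := eqVneq j i.
    by rewrite eqxx; move: le_i => /=; case: (phi i =P i) => [->|_]; lia.
  have /negbTE-> : phi j != phi i.
    by apply: contraNN ji => /eqP ?; apply/eqP/phi_inj; rewrite ?inE.
  by case: (phi j =P i) => [->|_]; lia.
rewrite big_split -[k.+1]addn1 leq_add ?f_le //.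
have -> : \sum_(j <- r) (j == i) = count_mem i r.
  by rewrite -sumn_count sumnE big_map.
by rewrite count_uniq_mem // leq_b1.
Qed.

Lemma ohara_flow_le n la : bounded_by_of_size a n la ->
  exists f : posint -> nat,
    (forall i, supp a i ->
       val (phi i) * (la (phi i)).+1 + weight a (phi i) * f (phi i) <=
       weight a i * (f i).+1)
    /\ (forall r, uniq r -> \sum_(i <- r) f i <= ohara_max_length a b phi n).
Proof.
have [[phiD _ _] _] := ab.
move=> la_n; have [k [mu [run bmu]]] := ohara_terminates la_n.1.
have [f [fP f_le]] := ohara_nsteps_balance run.
exists f; split=> [i si|r /f_le /leq_trans]; last first.
  by apply; rewrite -(ohara_lengthE run bmu) leq_ohara_max_length.
rewrite [weight a i]phi_equivalent_weight // /weight -!mulnA -mulnDr leq_mul2l.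
apply/orP; right; rewrite addSn -fP // mulnS -addSn leq_add2r.
by move/bounded_byP: bmu; apply; exact: phiD.
Qed.

Lemma ohara_edge_source_inj x y z :
  ohara_edge a phi x z -> ohara_edge a phi y z -> x = y.
Proof. by move=> [_ <-] [_ <-]. Qed.

Lemma ohara_edge_target_inj x y z :
  ohara_edge a phi x y -> ohara_edge a phi x z -> y = z.
Proof.
have [[_ phi_inj _] _] := ab.
by move=> [sy <-] [sz] /esym; apply: phi_inj; rewrite inE.
Qed.

(** ** Paths *)

Section Path.
Variable v : nat -> posint.
Hypotheses (v_inj : injective v) (v0_notin : ~ supp a (v 0)).
Hypothesis v_edge : forall k, ohara_edge a phi (v k) (v k.+1).

Lemma path_flow_ge c : exists f : nat -> nat,
  (forall k, c * val (v 0) <=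
     weight a (v k.+1) * f k + \sum_(j < k.+1) weight a (v j.+1))
  /\ (forall r, uniq r ->
        \sum_(k <- r) f k <= ohara_max_length a b phi (c * val (v 0))).
Proof.
have start : bounded_by_of_size a (c * val (v 0)) (msetn c (v 0)).
  split; last exact: psize_msetn.
  apply/bounded_byP => i si; rewrite msetnE ifN; first exact/entry_gt0.
  by apply: contra_not_neq v0_notin => <-.
have [f [fP f_le]] := ohara_flow_le start.
exists (f \o v \o succn); split; last first.
  move=> r ur; rewrite -(big_map (v \o succn) xpredT f) f_le //.
  by rewrite map_inj_uniq // => k l /v_inj[].
elim=> [|k IHk] /=.
  have [supp_v1 phi_v1] := v_edge 0; have := fP _ supp_v1.
  rewrite phi_v1 msetnxx big_ord1 -mulnSr; apply: leq_trans.
  by apply: leq_trans (leq_addr _ _); rewrite mulnC leq_mul2l leqnSn orbT.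
have [supp_vS phi_vS] := v_edge k.+1.
apply: (leq_trans IHk).
rewrite addnC [X in _ <= _ + X]big_ord_recr /= addnCA leq_add2l -mulnSr.
by have := fP _ supp_vS; rewrite phi_vS; apply: leq_trans; exact: leq_addl.
Qed.

End Path.

(** ** Cycles *)

Section Cycle.
Variables (k : nat) (f : 'I_k -> posint).
Hypotheses (f_inj : injective f) (one_notin : ~ supp a (pos 1)).
Hypothesis f_edge : forall p, ohara_edge a phi (f p) (f (ordS p)).

Let supp_cycle p : supp a (f p).
Proof. by rewrite -[p]ord_predK; case: (f_edge (ord_pred p)). Qed.

Lemma maximal_on_cycle n : \sum_p weight a (f p) <= n ->
  exists2 la, bounded_by_of_size a n la &
    forall p, (la (f p)).+1 = entry a (f p).
Proof.
move=> le_n.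
pose A := mset_of_counts f (fun p => (entry a (f p)).-1).
have AE p : A (f p) = (entry a (f p)).-1.
  rewrite mset_of_countsE (big_pred1 p) // => q /=.
  by rewrite (inj_eq f_inj) eq_sym.
have le_A : psize A <= n.
  apply: leq_trans le_n; rewrite psize_mset_of_counts; apply: leq_sum => p _.
  by rewrite mulnC leq_mul2l leq_pred orbT.
exists (A `+` msetn (n - psize A) (pos 1))%mset; last first.
  move=> p; rewrite msetE2 msetnE AE ifN ?addn0 ?prednK //.
    exact/entry_gt0/supp_cycle.
  by apply: contra_not_neq one_notin => <-; exact: supp_cycle.
split; last by rewrite psizeD psize_msetn val_pos // muln1 subnKC.
apply/bounded_byP => i si; have i_gt0 : 0 < entry a i by exact/entry_gt0.
rewrite msetE2 msetnE ifN ?addn0; last by apply: contra_not_neq one_notin => <-.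
have [[p ip]|not_f] := pselect (exists p, i = f p).
  by rewrite ip AE -ip prednK.
rewrite mset_of_countsE big_pred0 // => p.
by apply/negbTE/eqP => ip; apply: not_f; exists p.
Qed.

(* Started from the multiplicities [a_i - 1] on the cycle, a complete run
   creates parts [i] in [c i] steps such that [weight a i * (c i + 1)] cannot
   decrease along the cycle.  It is therefore constant, hence a common multiple
   of the weights. *)
Lemma leq_cycle_lcm_weight n p : \sum_p weight a (f p) <= n ->
  \big[lcmn/1]_q weight a (f q) <=
  weight a (f p) * (ohara_max_length a b phi n).+1.
Proof.
move=> /maximal_on_cycle[la la_n la_max].
have [c [cP c_le]] := ohara_flow_le la_n.
pose G q := weight a (f q) * (c (f q)).+1.
have G_mono q : G q <= G (ordS q).
  have [sq phiq] := f_edge q; have := cP _ sq.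
  by rewrite phiq la_max -/(weight _ _) -mulnS.
have G_cst : forall q, G q = G p := ord_cyclic_monotone_constant G_mono p.
apply: (@leq_trans (G p)).
  apply: dvdn_leq; first by rewrite muln_gt0 weight_gt0.
  by apply/dvdn_biglcmP => q _; rewrite -(G_cst q) dvdn_mulr.
rewrite leq_mul2l ltnS; apply/orP; right.
by have := c_le [:: f p] isT; rewrite big_seq1.
Qed.

End Cycle.

End OHara.

(** * Directed paths and cycles *)

Lemma is_dipath_nat (T : Type) (V : set T) (E : T -> T -> Prop) (v : nat -> T) :
  injective v -> range v = V -> (forall k l, E (v k) (v l) <-> l = k.+1) ->
  is_dipath V E.
Proof.
move=> v_inj vV vE.
exists [set p : int | (0 <= p)%R], (fun p : int => v `|p|%N); split.
- by exists 0%R => /=.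
- move=> x y /= x0 y0 z /andP[xz _]; exact: le_trans x0 xz.
- rewrite -vV; split.
  + by move=> p _; exists `|p|%N.
  + by move=> p q; rewrite !inE; case: p q => [p|//] [q|//] _ _ /v_inj /= ->.
  + by move=> _ [k _ <-]; exists (Posz k).
- by move=> [p|//] [q|//] _ _ /=; rewrite vE -PoszD addn1; split=> [->|[]].
Qed.

Lemma is_dicycle_component (T : Type) (E : T -> T -> Prop) k (f : 'I_k -> T) :
  (forall x y z, E x z -> E y z -> x = y) ->
  (forall x y z, E x y -> E x z -> y = z) ->
  injective f -> (forall p, E (f p) (f (ordS p))) ->
  forall p, is_dicycle k (component E (f p)) E.
Proof.
move=> source_inj target_inj f_inj f_edge p.
have component_sub x y :
    clos_refl_sym_trans _ E x y -> range f x <-> range f y.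
  elim=> {x y}; [|by []|by move=> x y _ []|].
  - move=> x y xy; split=> -[q _ fq]; move: xy; rewrite -fq => xy.
      by exists (ordS q) => //; exact: target_inj (f_edge q) xy.
    exists (ord_pred q) => //; apply: source_inj xy.
    by rewrite -[in X in E _ X](ord_predK q).
  - by move=> x y z _ -> _ ->.
exists f; split; first split.
- move=> + _; apply: (ordS_ind (p := p)); first exact: rst_refl.
  by move=> r pr; apply: rst_trans pr _; exact: rst_step.
- by move=> q r _ _ /f_inj.
- by move=> y /component_sub[+ _]; apply; exists p.
- move=> q r; split=> [fqr|->//].
  by apply: f_inj; exact: target_inj (f_edge q).
Qed.

(** * Sequences given by functions on integers *)

Definition extseq_of (c : nat -> nat) : extseq := fun i => insub (c (val i)).

Definition map_pos (p : nat -> nat) (i : posint) : posint := pos (p (val i)).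

Lemma entry_extseq_of c i : entry (extseq_of c) i = c (val i).
Proof.
rewrite /entry /extseq_of; case: insubP => [u _ <- //|] /=.
by rewrite lt0n negbK => /eqP.
Qed.

Lemma supp_extseq_of c i : supp (extseq_of c) i <-> 0 < c (val i).
Proof. by rewrite -entry_gt0 entry_extseq_of. Qed.

Lemma phi_equivalent_extseq_of (alpha beta p q : nat -> nat) :
  (forall i, 0 < i -> 0 < alpha i ->
     [/\ 0 < beta (p i), i * alpha i = p i * beta (p i) & q (p i) = i]) ->
  (forall j, 0 < j -> 0 < beta j ->
     [/\ 0 < q j, 0 < alpha (q j) & p (q j) = j]) ->
  phi_equivalent (extseq_of alpha) (extseq_of beta) (map_pos p).
Proof.
move=> pP qP.
have val_p i : 0 < alpha (val i) -> val (map_pos p i) = p (val i).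
  move=> a_gt0; have [_ eq_weight _] := pP _ (valP i) a_gt0.
  have : 0 < val i * alpha (val i) by rewrite muln_gt0 (valP i).
  by rewrite eq_weight muln_gt0 => /andP[p_gt0 _]; rewrite val_pos.
split; first split.
- move=> i /supp_extseq_of a_gt0; apply/supp_extseq_of; rewrite val_p //.
  by have [] := pP _ (valP i) a_gt0.
- move=> i j; rewrite !inE => /supp_extseq_of ai /supp_extseq_of aj.
  move=> /(congr1 val); rewrite !val_p // => pij; apply: val_inj.
  have [_ _ <-] := pP _ (valP i) ai; have [_ _ <-] := pP _ (valP j) aj.
  by rewrite pij.
- move=> j /supp_extseq_of b_gt0; have [q_gt0 aq pq] := qP _ (valP j) b_gt0.
  exists (map_pos q j); first by apply/supp_extseq_of; rewrite val_pos.
  by apply: val_inj; rewrite val_p val_pos.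
- move=> i k l ai bi.
  have a_gt0 : 0 < alpha (val i) by apply/supp_extseq_of; rewrite /supp /= ai.
  have [_ + _] := pP _ (valP i) a_gt0.
  rewrite -val_p // -(entry_extseq_of alpha) -(entry_extseq_of beta).
  by rewrite /entry ai bi.
Qed.

(** * The path *)

(* The path is [1 -> 2 -> 3 -> 6 -> 5 -> 10 -> 7 -> 14 -> ...]: every odd [x] is
   followed by [2 x] and then by [x + 2].  The weight moved along an edge is the
   least common multiple of its two ends. *)
Definition path_vertex (k : nat) : nat := if odd k then 2 * k else k.+1.

Definition path_pred (i : nat) : nat := if odd i then 2 * (i - 2) else i./2.

Definition path_succ (i : nat) : nat := if odd i then 2 * i else i./2 + 2.

Definition path_alpha (i : nat) : nat :=
  if i == 1 then 0 else if odd i then 2 * (i - 2)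
  else if i %% 4 == 2 then 1 else 0.

Definition path_beta (i : nat) : nat :=
  if odd i then 2 else if i %% 4 == 2 then i./2 + 2 else 0.

Definition path_a : extseq := extseq_of path_alpha.
Definition path_b : extseq := extseq_of path_beta.
Definition path_phi : posint -> posint := map_pos path_pred.

Lemma path_phi_equivalent : phi_equivalent path_a path_b path_phi.
Proof.
apply: (phi_equivalent_extseq_of (q := path_succ)) => i i_gt0;
  rewrite /path_alpha /path_beta /path_pred /path_succ.
  case: (i =P 1) => // i_neq1; case: ifP => odd_i a_gt0.
    have half_i : (2 * (i - 2))./2 + 2 = i by lia.
    by rewrite oddM /= half_i ifT; [split=> //; rewrite ?[i * _]mulnC|]; lia.
  case: eqP a_gt0 => // i_mod4 _; rewrite !ifT; [|lia|lia].
  by split; lia.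
case: ifP => odd_i b_gt0.
  by split; do ?[case: ifP => ?]; lia.
have i_mod4 : i %% 4 == 2 by case: ifP b_gt0.
by split; do ?[case: ifP => ?]; lia.
Qed.

Lemma path_vertex_gt0 k : 0 < path_vertex k.
Proof. by rewrite /path_vertex; case: ifP; lia. Qed.

Lemma path_vertex_inj : injective (pos \o path_vertex).
Proof.
move=> k l /(congr1 val); rewrite !val_pos ?path_vertex_gt0 //.
by rewrite /path_vertex; do 2![case: ifP => ?]; lia.
Qed.

Lemma path_vertex0_notin : ~ supp path_a (pos (path_vertex 0)).
Proof. by move=> /supp_extseq_of; rewrite val_pos. Qed.

Lemma path_edgeS k :
  ohara_edge path_a path_phi (pos (path_vertex k)) (pos (path_vertex k.+1)).
Proof.
split.
  apply/supp_extseq_of; rewrite val_pos ?path_vertex_gt0 //.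
  rewrite /path_alpha /path_vertex /=.
  by case: (boolP (odd k)) => ? /=; do ?[case: ifP => ?]; lia.
rewrite /path_phi /map_pos val_pos ?path_vertex_gt0 //; congr pos.
rewrite /path_pred /path_vertex /=.
by case: (boolP (odd k)) => ? /=; case: ifP; lia.
Qed.

Lemma path_is_dipath :
  is_dipath (ohara_vertices path_a path_b) (ohara_edge path_a path_phi).
Proof.
apply: (is_dipath_nat path_vertex_inj).
  apply/seteqP; split=> x.
    move=> [k _ <-]; right; apply/supp_extseq_of.
    rewrite val_pos ?path_vertex_gt0 // /path_beta /path_vertex.
    by case: (boolP (odd k)) => ? /=; do ?[case: ifP => ?]; lia.
  move=> Vx; exists (if odd (val x) then (val x).-1 else (val x)./2) => //.
  have x_mod4 : val x %% 4 != 0.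
    have : 0 < path_alpha (val x) + path_beta (val x).
      by case: Vx => /supp_extseq_of; rewrite addn_gt0 => ->; rewrite ?orbT.
    rewrite /path_alpha /path_beta; move: (val x) => i.
    by do ?[case: ifP => ?]; lia.
  rewrite /comp -[RHS]pos_val; congr pos; rewrite /path_vertex.
  move: (val x) (valP x) x_mod4 => i i_gt0 i_mod4.
  by case: (boolP (odd i)) => ? /=; case: ifP; lia.
move=> k l; split=> [|->]; last exact: path_edgeS.
case: l => [[/path_vertex0_notin]//|l] [_].
by case: (path_edgeS l) => _ -> /path_vertex_inj ->.
Qed.

Lemma weight_path k : weight path_a (pos (path_vertex k.+1)) =
  if odd k then k.+2 * (2 * k) else 2 * k.+1.
Proof.
rewrite /weight entry_extseq_of val_pos ?path_vertex_gt0 //.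
rewrite /path_alpha /path_vertex /=.
by case: (boolP (odd k)) => ? /=; do ?[case: ifP => ?]; lia.
Qed.

Lemma sum_weight_path_le j :
  \sum_(i < (2 * j).+1) weight path_a (pos (path_vertex i.+1)) <= 8 * j.+1 ^ 3.
Proof.
elim: j => [|j IHj]; first by rewrite big_ord1 weight_path.
have -> : (2 * j.+1).+1 = (2 * j).+3 by lia.
rewrite big_ord_recr big_ord_recr /= !weight_path /= oddM /=.
move: (\sum_(i < _) _) IHj => w; rewrite !expnS expn0; nia.
Qed.

Definition path_length : nat -> nat := ohara_max_length path_a path_b path_phi.

Lemma path_odd_steps n K : 16 * K ^ 3 <= n ->
  exists2 g : nat -> nat, (forall j, j < K -> n <= 8 * j.+1 * g j) &
    \sum_(0 <= j < K) g j <= path_length n.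
Proof.
move=> Kn.
have [f [f_ge f_le]] := path_flow_ge path_phi_equivalent path_vertex_inj
  path_vertex0_notin path_edgeS n.
rewrite /= val_pos // muln1 in f_ge f_le.
exists (fun j => f (2 * j)); last first.
  rewrite -(big_map (muln 2) xpredT f) f_le // map_inj_uniq ?iota_uniq //.
  by move=> i j; lia.
move=> j jK; have sum_le := sum_weight_path_le j.
have cube_le : 8 * j.+1 ^ 3 <= 8 * K ^ 3 by rewrite leq_mul2l /= leq_exp2r.
move: (f_ge (2 * j)) sum_le; rewrite weight_path oddM /=.
move: (\sum_(i < _) _) (f (2 * j)) => w x; nia.
Qed.

(** * Elementary number theory *)

Lemma between_consecutive (g : nat -> nat) n : g 0 <= n ->
  (forall t, t <= g t) -> exists t, g t <= n < g t.+1.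
Proof.
move=> g0 g_ge.
have [t gt maxt] := ex_maxnP (ex_intro (fun t => g t <= n) 0 g0)
  (fun t => leq_trans (g_ge t)).
by exists t; rewrite gt ltnNge; apply/negP => /maxt; rewrite ltnn.
Qed.

Lemma biglcmn_gt0 (I : finType) (P : pred I) (F : I -> nat) :
  (forall i, P i -> 0 < F i) -> 0 < \big[lcmn/1]_(i | P i) F i.
Proof.
move=> F_gt0; elim/big_ind: _ => // m n m_gt0 n_gt0.
by rewrite lcmn_gt0 m_gt0.
Qed.

(* Induction along the Leibniz harmonic triangle:
   [1 / D x k.+1 = 1 / D x k - 1 / D x.+1 k] for [D x k = x * 'C(x + k, k)]. *)
Lemma dvdn_bin_common_multiple k x G : 0 < x ->
  (forall i, x <= i <= x + k -> i %| G) -> x * 'C(x + k, k) %| G.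
Proof.
elim: k x => [|k IHk] x x_gt0 dvdG.
  by rewrite bin0 muln1; apply: dvdG; rewrite addn0 leqnn.
have /dvdnP[p Gp] : x * 'C(x + k, k) %| G.
  by apply: IHk => // i xi; apply: dvdG; lia.
have /dvdnP[q Gq] : x.+1 * 'C(x.+1 + k, k) %| G.
  by apply: IHk => // i xi; apply: dvdG; lia.
set D := x * 'C(x + k.+1, k.+1).
have D_diag : k.+1 * D = (x + k).+1 * (x * 'C(x + k, k)).
  rewrite /D mulnCA [RHS]mulnCA addnS; congr (x * _).
  by rewrite (mul_bin_diag (x + k).+1 k).
have D_left : k.+1 * D = x * (x.+1 * 'C(x.+1 + k, k)).
  rewrite /D mulnCA addnS addSn; congr (x * _).
  by rewrite mul_bin_left; congr (_ * _); lia.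
have G_diff : p * D = q * D + G.
  apply/eqP; rewrite -(eqn_pmul2l (ltn0Sn k)) mulnDr; apply/eqP.
  rewrite mulnCA D_diag [k.+1 * (q * _)]mulnCA D_left.
  by rewrite [p * _]mulnCA -Gp [q * _]mulnCA -Gq; lia.
have : D %| q * D + G by rewrite -G_diff dvdn_mull.
by rewrite dvdn_addr // dvdn_mull.
Qed.

Lemma leq_exp2_bin x k : k <= x -> 2 ^ k <= 'C(x + k, k).
Proof.
elim: k => [|k IHk] kx; first by rewrite bin0.
have /IHk {}IHk : k <= x by exact: ltnW.
rewrite -(leq_pmul2l (ltn0Sn k)) addnS -(mul_bin_diag (x + k).+1 k) /=.
by rewrite expnS mulnCA mulnA leq_mul //; lia.
Qed.

(** * Unions of cycles *)

Section Blocks.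
Variables cut scale : nat -> nat.
Hypotheses (cut0 : cut 0 = 2) (cut_lt : forall t, cut t < cut t.+1).
Hypothesis scale_gt0 : forall i, 0 < scale i.

(* The blocks [[cut t, cut t.+1)] partition the integers that are at least [2];
   each of them is a cycle, and [1] is kept as an inert part. *)
Definition block (i : nat) : nat := xget 0 [set t | cut t <= i < cut t.+1].

Definition block_pred (i : nat) : nat :=
  if i == cut (block i) then (cut (block i).+1).-1 else i.-1.

Definition block_succ (i : nat) : nat :=
  if i.+1 == cut (block i).+1 then cut (block i) else i.+1.

Definition block_a : extseq :=
  extseq_of (fun i => if 1 < i then block_pred i * scale i else 0).

Definition block_b : extseq :=
  extseq_of (fun i => if 1 < i then block_succ i * scale (block_succ i) else 0).

Definition block_phi : posint -> posint := map_pos block_pred.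

Definition block_length : nat -> nat :=
  ohara_max_length block_a block_b block_phi.

Definition block_size (t : nat) : nat := cut t.+1 - cut t.

Definition block_vertex (t : nat) (p : 'I_(block_size t)) : posint :=
  pos (cut t + p).

Lemma cut_homo t u : t <= u -> cut t <= cut u.
Proof. by apply: (@homo_leq _ cut leq leqnn leq_trans) => v; exact: ltnW. Qed.

Lemma cut_gt1 t : 1 < cut t.
Proof. by have := cut_homo (leq0n t); rewrite cut0. Qed.

Lemma leq_cut t : t <= cut t.
Proof. by elim: t => // t IHt; exact: leq_ltn_trans (cut_lt t). Qed.

Lemma block_uniq t i : cut t <= i < cut t.+1 -> block i = t.
Proof.
move=> /andP[ti it]; rewrite /block; case: xgetP => [u _ /andP[ui iu]|/(_ t)].
  have [/cut_homo|/cut_homo|//] := ltngtP u t; lia.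
by case; rewrite /= ti.
Qed.

Lemma blockP i : 1 < i -> cut (block i) <= i < cut (block i).+1.
Proof.
move=> i_gt1; have [|t ti] := @between_consecutive cut i _ leq_cut.
  by rewrite cut0.
by rewrite (block_uniq ti).
Qed.

Lemma block_predP i : 1 < i ->
  cut (block i) <= block_pred i < cut (block i).+1.
Proof.
move=> i_gt1; have := blockP i_gt1; have := cut_lt (block i).
by rewrite /block_pred; case: eqP; lia.
Qed.

Lemma block_succP i : 1 < i ->
  cut (block i) <= block_succ i < cut (block i).+1.
Proof.
move=> i_gt1; have := blockP i_gt1; have := cut_lt (block i).
by rewrite /block_succ; case: eqP; lia.
Qed.

Lemma block_pred_gt1 i : 1 < i -> 1 < block_pred i.
Proof. by move=> /block_predP/andP[+ _]; apply: leq_trans; exact: cut_gt1. Qed.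

Lemma block_succ_gt1 i : 1 < i -> 1 < block_succ i.
Proof. by move=> /block_succP/andP[+ _]; apply: leq_trans; exact: cut_gt1. Qed.

Lemma block_predK i : 1 < i -> block_succ (block_pred i) = i.
Proof.
move=> i_gt1; have bi := blockP i_gt1; have lt_cut := cut_lt (block i).
rewrite /block_succ (block_uniq (block_predP i_gt1)) /block_pred.
by case: (i =P cut (block i)) => ?; case: eqP => ?; lia.
Qed.

Lemma block_succK i : 1 < i -> block_pred (block_succ i) = i.
Proof.
move=> i_gt1; have bi := blockP i_gt1; have lt_cut := cut_lt (block i).
rewrite /block_pred (block_uniq (block_succP i_gt1)) /block_succ.
by case: (i.+1 =P cut (block i).+1) => ?; case: eqP => ?; lia.
Qed.

Lemma supp_block_a i : supp block_a i <-> 1 < val i.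
Proof.
rewrite supp_extseq_of; case: ifP => // i_gt1.
by rewrite muln_gt0 scale_gt0 ltnW // block_pred_gt1.
Qed.

Lemma supp_block_b i : supp block_b i <-> 1 < val i.
Proof.
rewrite supp_extseq_of; case: ifP => // i_gt1.
by rewrite muln_gt0 scale_gt0 ltnW // block_succ_gt1.
Qed.

Lemma block_phi_equivalent : phi_equivalent block_a block_b block_phi.
Proof.
apply: (phi_equivalent_extseq_of (q := block_succ)) => i i_gt0.
  case: ifP => // i_gt1 _; have pred_gt1 := block_pred_gt1 i_gt1.
  rewrite pred_gt1 block_predK // muln_gt0 scale_gt0 andbT.
  by split; [exact: ltnW|rewrite mulnCA|].
case: ifP => // i_gt1 _; have succ_gt1 := block_succ_gt1 i_gt1.
rewrite succ_gt1 block_succK // muln_gt0 scale_gt0 andbT.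
by split; [exact: ltnW|exact: ltnW|].
Qed.

Lemma block_vertexP t (p : 'I_(block_size t)) : cut t <= cut t + p < cut t.+1.
Proof. by have := ltn_ord p; rewrite /block_size; lia. Qed.

Lemma val_block_vertex t (p : 'I_(block_size t)) :
  val (block_vertex p) = cut t + p.
Proof. by rewrite val_pos // addn_gt0 ltnW // cut_gt1. Qed.

Lemma block_vertex_inj t : injective (@block_vertex t).
Proof.
move=> p q /(congr1 val); rewrite !val_block_vertex => /addnI.
exact: val_inj.
Qed.

Lemma block_edge t (p : 'I_(block_size t)) :
  ohara_edge block_a block_phi (block_vertex p) (block_vertex (ordS p)).
Proof.
have cut_t_gt1 := cut_gt1 t; split.
  by apply/supp_block_a; rewrite val_block_vertex; lia.
rewrite /block_phi /map_pos val_block_vertex; congr pos.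
rewrite /block_pred (block_uniq (block_vertexP _)) /=.
have := ltn_ord p; have [pS|pS] := eqVneq p.+1 (block_size t) => p_lt.
  by rewrite pS modnn addn0 eqxx; move: pS; rewrite /block_size; lia.
rewrite modn_small ?ifF; lia.
Qed.

Lemma block_only_dicycles m : (forall t, cut t.+1 <= cut t + m) ->
  only_dicycles_of_length_le m
    (ohara_vertices block_a block_b) (ohara_edge block_a block_phi).
Proof.
move=> cut_le v Vv.
have v_gt1 : 1 < val v by case: Vv => [/supp_block_a|/supp_block_b].
have /andP[vl vr] := blockP v_gt1; set t := block (val v) in vl vr.
have v_lt : val v - cut t < block_size t by rewrite /block_size; lia.
exists (block_size t); first by rewrite leq_subLR.
have -> : v = block_vertex (Ordinal v_lt).
  by apply: val_inj; rewrite val_block_vertex /= subnKC.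
apply: is_dicycle_component; last exact: block_edge.
- exact: ohara_edge_source_inj.
- exact: ohara_edge_target_inj block_phi_equivalent.
- exact: block_vertex_inj.
Qed.

Definition block_weight (i : nat) : nat := i * block_pred i * scale i.

Lemma weight_block_vertex t (p : 'I_(block_size t)) :
  weight block_a (block_vertex p) = block_weight (cut t + p).
Proof.
rewrite /weight entry_extseq_of val_block_vertex ifT ?mulnA //.
by rewrite ltn_addr // cut_gt1.
Qed.

Lemma leq_block_weight t i :
  cut t <= i < cut t.+1 -> block_weight i <= cut t.+1 ^ 2 * scale i.
Proof.
move=> it; have cut_t_gt1 := cut_gt1 t.
have := @block_predP i; rewrite (block_uniq it) -mulnn => pt.
by rewrite /block_weight !leq_mul //; lia.
Qed.

Lemma block_weight_gt0 i : 1 < i -> 0 < block_weight i.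
Proof.
move=> i_gt1; have pred_gt1 := block_pred_gt1 i_gt1.
by rewrite !muln_gt0 scale_gt0 (ltnW i_gt1) (ltnW pred_gt1).
Qed.

Lemma dvdn_block_lcm_le t Q n d :
  (forall i, cut t <= i < cut t.+1 -> cut t.+1 ^ 2 * scale i <= Q) ->
  block_size t * Q <= n ->
  d %| \big[lcmn/1]_(p < block_size t) block_weight (cut t + p) ->
  d <= Q * (block_length n).+1.
Proof.
move=> le_Q Qn /dvdn_leq d_le; apply: leq_trans (d_le _) _.
  apply: biglcmn_gt0 => p _; apply: block_weight_gt0.
  by rewrite ltn_addr // cut_gt1.
have weight_le p : weight block_a (@block_vertex t p) <= Q.
  rewrite weight_block_vertex; have p_in := block_vertexP p.
  exact: leq_trans (leq_block_weight p_in) (le_Q _ p_in).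
have sum_le : \sum_p weight block_a (@block_vertex t p) <= n.
  apply: leq_trans (leq_sum _ (fun p _ => weight_le p)) _.
  by rewrite sum_nat_const card_ord.
have size_gt0 : 0 < block_size t by rewrite subn_gt0.
have one_notin : ~ supp block_a (pos 1).
  by move=> /supp_block_a; rewrite val_pos.
have := leq_cycle_lcm_weight block_phi_equivalent (@block_vertex_inj t)
  one_notin (@block_edge t) (Ordinal size_gt0) sum_le.
under eq_bigr do rewrite weight_block_vertex.
by move=> /leq_trans; apply; rewrite leq_mul2r weight_le orbT.
Qed.

End Blocks.

(** * Exponential growth: the cycles on [2 ^ t, ..., 2 ^ t.+1 - 1] *)

Definition exp_cut (t : nat) : nat := 2 ^ t.+1.

Definition exp_scale (_ : nat) : nat := 1.

Definition exp_length : nat -> nat := block_length exp_cut exp_scale.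

Lemma exp_cut_lt t : exp_cut t < exp_cut t.+1.
Proof. by rewrite ltn_exp2l. Qed.

Lemma exp_block_size t : block_size exp_cut t = 2 ^ t.+1.
Proof. by rewrite /block_size /exp_cut expnS mul2n -addnn addnK. Qed.

Lemma dvdn_exp_block_lcm t :
  exp_cut t * 'C(exp_cut t + (exp_cut t).-1, (exp_cut t).-1) %|
  \big[lcmn/1]_(p < block_size exp_cut t)
    block_weight exp_cut exp_scale (exp_cut t + p).
Proof.
have cut_gt0 : 0 < exp_cut t by rewrite expn_gt0.
apply: dvdn_bin_common_multiple => // i it.
have p_lt : i - exp_cut t < block_size exp_cut t.
  by rewrite exp_block_size -/(exp_cut t); lia.
apply: (biglcmn_sup (Ordinal p_lt)) => //=; rewrite subnKC; last lia.
by rewrite /block_weight -mulnA dvdn_mulr.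
Qed.

Lemma exp_length_ge t n : 3 <= t -> 2 ^ (3 * t + 5) <= n ->
  2 ^ 2 ^ t <= exp_length n.
Proof.
move=> t_ge3 tn.
have t_le : t + 5 <= 2 ^ t.
  elim: t t_ge3 {tn} => // t IHt.
  by rewrite leq_eqVlt => /predU1P[<-//|/IHt]; rewrite expnS; lia.
have bin_le : 2 ^ (2 * t + 4) * 2 ^ (2 ^ t + (2 ^ t - t - 4)) <=
    exp_cut t * 'C(exp_cut t + (exp_cut t).-1, (exp_cut t).-1).
  rewrite -expnD [X in 2 ^ X](_ : _ = t.+1 + (exp_cut t).-1); last first.
    by rewrite /exp_cut expnS; lia.
  by rewrite expnD leq_mul // leq_exp2_bin // leq_pred.
have exp_le : 2 ^ (2 * t + 4) * 2 ^ (2 ^ t + (2 ^ t - t - 4)) <=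
    2 ^ (2 * t + 4) * (exp_length n).+1.
  apply: leq_trans bin_le _.
  apply: dvdn_block_lcm_le (dvdn_exp_block_lcm t) => //.
  - exact: exp_cut_lt.
  - by move=> i _; rewrite /exp_cut muln1 -expnM leq_exp2l //; lia.
  - by apply: leq_trans tn; rewrite exp_block_size -expnD leq_exp2l //; lia.
rewrite leq_pmul2l ?expn_gt0 // in exp_le.
by rewrite -ltnS; apply: leq_trans exp_le; rewrite ltn_exp2l //; lia.
Qed.

Lemma exp_length_growth n : 2 ^ 14 <= n ->
  exists2 t, 2 ^ 2 ^ t <= exp_length n & n <= (2 ^ t.+3) ^ 3.
Proof.
move=> n_ge.
have [//|t|t /andP[tn nt]] :=
    @between_consecutive (fun t => 2 ^ (3 * (t + 3) + 5)) n.
  apply: leq_trans (ltnW (ltn_expl _ (ltnSn 1))) _; rewrite leq_exp2l //; lia.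
exists (t + 3); first by apply: exp_length_ge tn; lia.
by apply: leq_trans (ltnW nt) _; rewrite -expnM leq_exp2l //; lia.
Qed.

(** * Polynomial growth: cycles of length [m] *)

Section PolynomialGrowth.
Variable m : nat.
Hypothesis m_gt1 : 1 < m.

Definition poly_cut (t : nat) : nat := 2 + m * t.

(* Pairwise coprime inside a block, since [m`!] is a multiple of the differences
   of the positions. *)
Definition poly_scale (i : nat) : nat :=
  ((i - 2) %% m).+1 * (m`! * 2 ^ ((i - 2) %/ m)) + 1.

Definition poly_length : nat -> nat := block_length poly_cut poly_scale.

Definition poly_const : nat := 2 * m ^ 3 * m`!.

Definition poly_weight_bound (t : nat) : nat :=
  poly_const * (t + 2) ^ 2 * 2 ^ t.

Lemma poly_const_gt0 : 0 < poly_const.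
Proof. by rewrite /poly_const !muln_gt0 fact_gt0 (ltnW m_gt1). Qed.

Lemma poly_cut0 : poly_cut 0 = 2.
Proof. by rewrite /poly_cut muln0. Qed.

Lemma poly_cut_lt t : poly_cut t < poly_cut t.+1.
Proof. by rewrite /poly_cut mulnS; lia. Qed.

Lemma poly_block_size t : block_size poly_cut t = m.
Proof. by rewrite /block_size /poly_cut mulnS; lia. Qed.

Lemma poly_scale_gt0 i : 0 < poly_scale i.
Proof. by rewrite /poly_scale addn1. Qed.

Lemma poly_scaleE t k :
  k < m -> poly_scale (poly_cut t + k) = k.+1 * (m`! * 2 ^ t) + 1.
Proof.
move=> km; rewrite /poly_scale /poly_cut.
have -> : 2 + m * t + k - 2 = t * m + k by lia.
by rewrite modnMDl divnMDl ?modn_small ?divn_small ?addn0 //; lia.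
Qed.

Lemma coprime_poly_scale t i j : i < j < m ->
  coprime (poly_scale (poly_cut t + i)) (poly_scale (poly_cut t + j)).
Proof.
move=> /andP[ij jm]; rewrite !poly_scaleE //; last lia.
set M := m`! * 2 ^ t.
have coprime_M : coprime (i.+1 * M + 1) M.
  by rewrite coprime_sym /coprime gcdnMDl gcdn1.
have -> : j.+1 * M + 1 = (i.+1 * M + 1) + (j - i) * M by nia.
rewrite /coprime gcdnDl -/(coprime _ _) coprimeMr coprime_M andbT.
by apply: coprime_dvdr coprime_M; rewrite dvdn_mulr // dvdn_fact //; lia.
Qed.

Lemma poly_weight_le t i : poly_cut t <= i < poly_cut t.+1 ->
  poly_cut t.+1 ^ 2 * poly_scale i <= poly_weight_bound t.
Proof.
move=> it; have iE : i = poly_cut t + (i - poly_cut t) by lia.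
have k_lt : i - poly_cut t < m by rewrite /poly_cut in it *; lia.
have cut_le : poly_cut t.+1 <= m * (t + 2) by rewrite /poly_cut; nia.
have scale_le : poly_scale i <= 2 * (m * (m`! * 2 ^ t)).
  rewrite iE poly_scaleE // mul2n -addnn leq_add ?leq_mul2r ?k_lt ?orbT //.
  by rewrite !muln_gt0 fact_gt0 expn_gt0 (ltnW m_gt1).
have -> : poly_weight_bound t = (m * (t + 2)) ^ 2 * (2 * (m * (m`! * 2 ^ t))).
  by rewrite /poly_weight_bound /poly_const expnMn !expnS expn0; lia.
by rewrite leq_mul // leq_exp2r.
Qed.

Lemma dvdn_poly_block_lcm t :
  \prod_(p < m) poly_scale (poly_cut t + p) %|
  \big[lcmn/1]_(p < block_size poly_cut t)
    block_weight poly_cut poly_scale (poly_cut t + p).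
Proof.
rewrite poly_block_size.
rewrite -(big_mkord xpredT (fun p => poly_scale (poly_cut t + p))).
apply/Gauss_dvd_prod => [|p]; last first.
  rewrite mem_index_iota => /= p_lt _.
  by apply: (biglcmn_sup (Ordinal p_lt)) => //=; rewrite dvdn_mull.
rewrite filter_predT pairwise_map; apply/(pairwiseP 0) => i j.
rewrite !inE size_iota subn0 => i_lt j_lt ij; rewrite !nth_iota ?subn0 //.
by rewrite /= coprime_poly_scale // ij.
Qed.

Lemma poly_length_ge t n : m * poly_weight_bound t <= n ->
  2 ^ (t * m) <= poly_weight_bound t * (poly_length n).+1.
Proof.
move=> tn; apply: (@leq_trans (\prod_(p < m) poly_scale (poly_cut t + p))).
  rewrite expnM -[X in _ ^ X]card_ord -prod_nat_const.
  apply: leq_prod => p _; rewrite poly_scaleE // addn1 mulnA ltnW // ltnS.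
  by rewrite leq_pmull // muln_gt0 fact_gt0.
apply: dvdn_block_lcm_le (dvdn_poly_block_lcm t).
- exact: poly_cut0.
- exact: poly_cut_lt.
- exact: poly_scale_gt0.
- exact: poly_weight_le.
- by rewrite poly_block_size.
Qed.

Lemma poly_length_growth n : m * poly_weight_bound 0 <= n ->
  exists2 t, 2 ^ t <= n & n ^ m.-1 <=
    (2 * m * poly_const) ^ m.-1 * poly_const * (t + 3) ^ (2 * m) *
    (poly_length n).+1.
Proof.
move=> n_ge; set c := poly_const.
have bound_ge t : 2 ^ t <= m * poly_weight_bound t.
  rewrite /poly_weight_bound mulnA leq_pmull // muln_gt0 (ltnW m_gt1).
  by rewrite muln_gt0 poly_const_gt0 expn_gt0 addn2.
have [|t /andP[tn nt]] :=
    @between_consecutive (fun t => m * poly_weight_bound t) n n_ge.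
  by move=> t; apply: leq_trans (bound_ge t); exact/ltnW/ltn_expl.
exists t; first exact: leq_trans (bound_ge t) tn.
have n_le : n <= 2 * m * c * (t + 3) ^ 2 * 2 ^ t.
  apply: leq_trans (ltnW nt) _.
  rewrite /poly_weight_bound -/c [2 ^ _.+1]expnS addSnnS.
  by move: ((t + 3) ^ 2) (2 ^ t) => x y; lia.
have pow_le : (2 ^ t) ^ m.-1 <= c * (t + 3) ^ 2 * (poly_length n).+1.
  have exp2_gt0 : 0 < 2 ^ t by rewrite expn_gt0.
  rewrite -(leq_pmul2l exp2_gt0) -expnS prednK ?(ltnW m_gt1) // -expnM.
  apply: leq_trans (poly_length_ge tn) _; rewrite /poly_weight_bound -/c.
  by rewrite mulnA [2 ^ t * _]mulnC !leq_mul // leq_add2l.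
have pred_gt0 : 0 < m.-1 by rewrite -subn1 subn_gt0.
rewrite -(leq_exp2r _ _ pred_gt0) in n_le; apply: (leq_trans n_le).
rewrite expnMn; apply: leq_trans (leq_mul (leqnn _) pow_le) _.
have pow_2m x : x ^ (2 * m) = (x ^ 2) ^ m.-1 * x ^ 2.
  by rewrite -expnM -expnD; congr (_ ^ _); lia.
rewrite pow_2m [(_ * (t + 3) ^ 2) ^ _]expnMn.
by move: ((t + 3) ^ 2) (((t + 3) ^ 2) ^ _) ((2 * m * c) ^ _) => x y z; lia.
Qed.

End PolynomialGrowth.

(** * Asymptotics *)

Local Open Scope ring_scope.

Section Asymptotics.
Variable R : realType.

Lemma bigOmega_ge0 (T : Type) (F : set_system T) (f g : T -> R) (k : R) :
  Filter F -> 0 < k -> (\forall x \near F, 0 <= g x <= k * f x) ->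
  f \is 'Omega_F g.
Proof.
move=> FF k_gt0 fg; rewrite qualifE; apply/asboolP.
exists k^-1; first by rewrite invr_gt0.
near=> x; have /andP[g_ge0 gf] : 0 <= g x <= k * f x by near: x.
have f_ge0 : 0 <= f x by rewrite -(pmulr_rge0 _ k_gt0) (le_trans g_ge0).
by rewrite !ger0_norm // ler_pdivrMl.
Unshelve. all: by end_near. Qed.

Lemma ln_le_series_harmonic K : ln K.+1%:R <= series harmonic K :> R.
Proof.
elim: K => [|K IHK]; first by rewrite ln1 /series /= big_geq.
have K_gt0 : 0 < K.+1%:R :> R by rewrite ltr0n.
have inv_gt0 : 0 < K.+1%:R^-1 :> R by rewrite invr_gt0.
have -> : K.+2%:R = K.+1%:R * (1 + K.+1%:R^-1) :> R.
  by rewrite mulrDr mulr1 divff ?lt0r_neq0 // natr1.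
rewrite lnM ?posrE ?addr_gt0 // /series /= big_nat_recr //=.
by apply: lerD => //; apply: le_ln1Dx; exact: lt_trans (ltrN10 _) inv_gt0.
Qed.

Lemma path_length_ge n K : (16 * K ^ 3 <= n)%N ->
  n%:R * ln K.+1%:R <= 8 * (path_length n)%:R :> R.
Proof.
move=> /path_odd_steps[g g_ge g_le].
apply: le_trans (_ : 8 * (\sum_(0 <= j < K) g j)%N%:R <= _); last first.
  by rewrite ler_pM2l ?ltr0n // ler_nat.
apply: le_trans (ler_wpM2l (ler0n _ _) (ln_le_series_harmonic K)) _.
rewrite /series /= natr_sum !mulr_sumr !big_mkord; apply: ler_sum => j _.
by rewrite ler_pdivrMr ?ltr0n // -!natrM ler_nat mulnAC g_ge.
Qed.

Lemma path_length_omega :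
  (fun n : nat => (path_length n)%:R : R)
    \is 'Omega_\oo (fun n : nat => n%:R * ln (ln n%:R) : R).
Proof.
apply: (@bigOmega_ge0 _ _ _ _ 56); first by rewrite ltr0n.
near=> n.
have n16 : (16 <= n)%N by near: n; exact: nbhs_infty_ge.
have n_ge_e : expR 1 <= n%:R :> R by near: n; exact: nbhs_infty_ger.
have n_gt0 : 0 < n%:R :> R by rewrite ltr0n; lia.
have ln_ge1 : 1 <= ln (n%:R : R) by rewrite -ler_expR lnK.
rewrite mulr_ge0 ?(ltW n_gt0) ?ln_ge0 //=.
have [|t|t /andP[tn nt]] := @between_consecutive (fun t => 16 * t.+1 ^ 3)%N n.
- by rewrite exp1n muln1.
- by rewrite !expnS expn0; nia.
have lnln_le : ln (ln (n%:R : R)) <= ln n%:R.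
  by apply/ltW/ln_sublinear/(lt_le_trans _ ln_ge1).
have ln_le : ln n%:R <= 7 * ln t.+2%:R :> R.
  rewrite mulr_natl -lnXn ?ltr0n // ler_ln ?posrE ?n_gt0 ?exprn_gt0 ?ltr0n //.
  rewrite -natrX ler_nat; apply: leq_trans (ltnW nt) _.
  rewrite (expnD _ 4 3) leq_mul2r; apply/orP; right.
  by rewrite -[16%N]/(2 ^ 4)%N leq_exp2r.
apply: le_trans (ler_wpM2l (ltW n_gt0) (le_trans lnln_le ln_le)) _.
rewrite mulrCA -[56]/((7 * 8)%:R) natrM -mulrA ler_pM2l ?ltr0n //.
exact: path_length_ge.
Unshelve. all: by end_near. Qed.

Lemma exp_length_gt0 : \forall n \near \oo, (0 < exp_length n)%N.
Proof.
near=> n; have [|t t_le _] := @exp_length_growth n.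
  by near: n; exact: nbhs_infty_ge.
by apply: leq_trans t_le; rewrite expn_gt0.
Unshelve. all: by end_near. Qed.

Lemma ln_exp_length_omega :
  (fun n => ln ((exp_length n)%:R : R)) \is 'Omega_\oo
    (fun n => n%:R `^ (3^-1) : R).
Proof.
have ln2_gt0 : 0 < ln 2 :> R by rewrite ln_gt0 // ltr1n.
apply: (@bigOmega_ge0 _ _ _ _ (8 / ln 2)); first by rewrite divr_gt0.
near=> n; rewrite powR_ge0 /=.
have [|t t_le nt] := @exp_length_growth n.
  by near: n; exact: nbhs_infty_ge.
have root_le : n%:R `^ 3^-1 <= 8 * (2 ^ t)%N%:R :> R.
  apply: le_trans (_ : ((2 ^ t.+3) ^ 3)%N%:R `^ 3^-1 <= _).
    by rewrite ge0_ler_powR ?nnegrE ?invr_ge0 // ler_nat.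
  rewrite natrX -powR_mulrn // -powRrM divff // powRr1 //.
  by rewrite -[t.+3]addn3 expnD mulnC natrM.
have ln_ge : (2 ^ t)%N%:R * ln 2 <= ln (exp_length n)%:R :> R.
  rewrite mulr_natl -lnXn // -natrX ler_ln ?posrE ?ltr0n ?expn_gt0 ?ler_nat //.
  by near: n; exact: exp_length_gt0.
apply: (le_trans root_le).
by rewrite -mulrA ler_pM2l // mulrC ler_pdivlMr.
Unshelve. all: by end_near. Qed.

Lemma pow_le_powR_exp2 (e : R) (c d : nat) : 0 < e ->
  exists2 K : R, 0 < K & forall t, (t + c)%:R ^+ d <= K * (2 ^+ t) `^ e.
Proof.
move=> e_gt0; case: d => [|d].
  exists 1 => // t; rewrite mul1r expr0 -[leLHS](powRr0 (2 ^+ t)).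
  by rewrite ler_powR ?exprn_ege1 ?ler1n // ltW.
have ln2_gt0 : 0 < ln 2 :> R by rewrite ln_gt0 // ltr1n.
pose r : R := e * ln 2 / d.+1%:R.
have r_gt0 : 0 < r by rewrite divr_gt0 ?mulr_gt0.
exists (r^-1 ^+ d.+1 * expR (c%:R * (e * ln 2))).
  by rewrite mulr_gt0 ?exprn_gt0 ?invr_gt0 ?expR_gt0.
move=> t; set x : R := (t + c)%:R.
have x_le : x <= r^-1 * expR (r * x).
  by rewrite ler_pdivlMl //; apply: le_trans (expR_ge1Dx _); rewrite lerDr.
have exp2E : (2 ^+ t) `^ e = expR (t%:R * (e * ln 2)) :> R.
  by rewrite /powR gt_eqF ?exprn_gt0 // lnXn // -(mulr_natl (ln _)) mulrCA.
have xE : d.+1%:R * (r * x) = c%:R * (e * ln 2) + t%:R * (e * ln 2).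
  by rewrite /r /x natrD; field; rewrite lt0r_neq0.
rewrite exp2E -mulrA -expRD -xE expRM_natl -exprMn lerXn2r ?nnegrE //.
by rewrite mulr_ge0 ?invr_ge0 ?expR_ge0 // ltW.
Qed.

Section PolynomialGrowth.
Variable m : nat.
Hypothesis m_gt1 : (1 < m)%N.

Lemma poly_length_powR (e : R) : 0 < e ->
  exists2 K : R, 0 < K &
    \forall n \near \oo, n%:R `^ (m%:R - 1 - e) <= K * (poly_length m n).+1%:R.
Proof.
move=> e_gt0.
have [K K_gt0 K_ge] := pow_le_powR_exp2 3 (2 * m) e_gt0.
pose C := ((2 * m * poly_const m) ^ m.-1 * poly_const m)%N.
have C_gt0 : (0 < C)%N.
  rewrite muln_gt0 poly_const_gt0 // andbT expn_gt0.
  by rewrite muln_gt0 poly_const_gt0 // andbT; lia.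
exists (C%:R * K); first by rewrite mulr_gt0 ?ltr0n.
near=> n.
have n_gt0 : 0 < n%:R :> R by rewrite ltr0n; near: n; exact: nbhs_infty_ge.
have [|t tn n_le] := @poly_length_growth m m_gt1 n.
  by near: n; exact: nbhs_infty_ge.
rewrite powRB ?lt0r_neq0 ?implybT // ler_pdivrMr ?powR_gt0 //.
rewrite -(natrB _ (ltnW m_gt1)) subn1 powR_mulrn ?(ltW n_gt0) //.
apply: le_trans (_ : C%:R * (t + 3)%:R ^+ (2 * m) *
    (poly_length m n).+1%:R <= _); first by rewrite -!natrX -!natrM ler_nat.
rewrite [leRHS]mulrAC ler_pM2r ?ltr0n // -mulrA ler_pM2l ?ltr0n //.
apply: le_trans (K_ge t) _; rewrite ler_pM2l //.
rewrite ge0_ler_powR ?nnegrE ?exprn_ge0 ?ler0n ?(ltW e_gt0) //.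
by rewrite -natrX ler_nat.
Unshelve. all: by end_near. Qed.

Lemma poly_length_gt0 : \forall n \near \oo, (0 < poly_length m n)%N.
Proof.
have [|K K_gt0 K_ge] := @poly_length_powR 2^-1; first by rewrite invr_gt0.
near=> n; rewrite lt0n; apply/eqP => length0.
have n_ge1 : 1 <= n%:R :> R by rewrite ler1n; near: n; exact: nbhs_infty_ge.
have n_gt : (K + 1) ^+ 2 <= n%:R :> R by near: n; exact: nbhs_infty_ger.
have m_ge2 : 2 <= m%:R :> R by rewrite ler_nat.
have : n%:R `^ (m%:R - 1 - 2^-1) <= K * (poly_length m n).+1%:R :> R by near: n.
rewrite length0 mulr1; apply/negP; rewrite -ltNge.
apply: lt_le_trans (_ : n%:R `^ 2^-1 <= _); last by apply: ler_powR => //; lra.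
rewrite powR12_sqrt ?(le_trans ler01) //.
apply: lt_le_trans (ler_wsqrtr n_gt).
by rewrite sqrtr_sqr ger0_norm; lra.
Unshelve. all: by end_near. Qed.

Lemma poly_length_omega (eps : R) : 0 < eps ->
  (fun n : nat => (poly_length m n)%:R : R)
    \is 'Omega_\oo (fun n : nat => n%:R `^ (m%:R - 1 - eps) : R).
Proof.
move=> /poly_length_powR[K K_gt0 K_ge].
apply: (@bigOmega_ge0 _ _ _ _ (2 * K)); first by rewrite mulr_gt0.
near=> n; rewrite powR_ge0 /=.
apply: le_trans (_ : K * (poly_length m n).+1%:R <= _); first by near: n.
rewrite mulrAC mulrC ler_pM2r // -natrM ler_nat mul2n -addnn -addn1 leq_add2l.
by near: n; exact: poly_length_gt0.
Unshelve. all: by end_near. Qed.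

End PolynomialGrowth.

End Asymptotics.

Theorem theorem3p7 (R : realType) :
  [/\ (exists (a b : extseq) (phi : posint -> posint),
         [/\ phi_equivalent a b phi,
             is_dipath (ohara_vertices a b) (ohara_edge a phi) &
             (fun n : nat => (ohara_max_length a b phi n)%:R : R)
               \is 'Omega_\oo (fun n : nat => n%:R * ln (ln n%:R) : R)]),
      (forall m : nat, (2 <= m)%N ->
         exists (a b : extseq) (phi : posint -> posint),
         [/\ phi_equivalent a b phi,
             only_dicycles_of_length_le m
               (ohara_vertices a b) (ohara_edge a phi) &
             forall eps : R, 0 < eps ->
               (fun n : nat => (ohara_max_length a b phi n)%:R : R)
                 \is 'Omega_\oo (fun n : nat => n%:R `^ (m%:R - 1 - eps) : R)]) &
      (exists (a b : extseq) (phi : posint -> posint),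
         phi_equivalent a b phi /\
         exists2 h : nat -> R,
           h \is 'Omega_\oo (fun n : nat => n%:R `^ (3%:R^-1) : R) &
           \forall n \near \oo,
             (ohara_max_length a b phi n)%:R = expR (h n))].
Proof.
split.
- exists path_a, path_b, path_phi; split.
  + exact: path_phi_equivalent.
  + exact: path_is_dipath.
  + exact: path_length_omega.
- move=> m m_gt1; have cut0 := poly_cut0 m.
  exists (block_a (poly_cut m) (poly_scale m)),
    (block_b (poly_cut m) (poly_scale m)), (block_phi (poly_cut m)); split.
  + exact: block_phi_equivalent cut0 (poly_cut_lt m_gt1) (@poly_scale_gt0 m).
  + apply: block_only_dicycles cut0 (poly_cut_lt m_gt1) (@poly_scale_gt0 m) _ _.
    by move=> t; rewrite /poly_cut mulnS addnCA addnC.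
  + by move=> eps; exact: poly_length_omega.
- exists (block_a exp_cut exp_scale), (block_b exp_cut exp_scale),
    (block_phi exp_cut); split.
    by apply: block_phi_equivalent => //; exact: exp_cut_lt.
  exists (fun n => ln (exp_length n)%:R); first exact: ln_exp_length_omega.
  near=> n; rewrite lnK // posrE ltr0n.
  by near: n; exact: exp_length_gt0.
Unshelve. all: by end_near. Qed.
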